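(* Let $i\ge-1$, $n\ge1$ and $0\le r\le n+i$. The map $$\phi_{i,n}^r:\{C\in\mathcal C_i(n)\mid C\notin\mathcal F_i^j(n)\text{ for all } j\in[r]\}\to\mathcal F_i^{r+1}(n+1),\qquad C\mapsto\widehat C(r),$$ is well defined and is a bijection.
   Context: Young diagrams use English notation: rows indexed $1,2,\dots$ top to bottom, columns $1,2,\dots$ left to right, $(x,y)$ the box in row $x$, column $y$, row lengths $\lambda_1\ge\lambda_2\ge\cdots$, $\lambda_j=0$ beyond the last row, $\lambda_0=+\infty$. $\delta_m=(m,\dots,1)$ ($m\ge1$), $\delta_m=\emptyset$ ($m\le0$); $[m]=\{1,\dots,m\}$, $[0]=\emptyset$. For $d\ge1$, $h_Y(d)=\min\{h\ge1:\lambda_{d-h}\ge\lambda_d+h\}$ is the height of the prime path of row $d$. If $B$ is the last box of row $x_B$, the $B$-strip is the set of last boxes of rows $x_B-h_Y(x_B)+1,\dots,x_B$; $B$ is a corner box if it is also lowest in its column. $Y'\gtrdot Y$ if $Y'$ is $Y$ with the $B$-strip of some corner box $B$ deleted. $\mathcal T_n$ is the set of Young diagrams contained in $\delta_{n-1}$ with the order generated by $\gtrdot$. A tableau $T$ fills a Young diagram with positive integers, rows strictly increasing left to right, columns weakly increasing downward, label set exactly $[l]$, $l=l(T)$; $T(x,y)$ denotes a label; $r$-set = boxes labelled $r$; $T^{(r)}$ = boxes with labels $\le r$; the end-box of a set of boxes is its box in the row of largest index. A $\psi$-tableau is a tableau with $sh(T^{(r-1)})\gtrdot sh(T^{(r)})$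 for all $r\in[l(T)]$. For a $\psi$-tableau $C$ of shape $\delta_{n-1}$ (outer diagonal $\{(k,n-k):k\in[n-1]\}$): the $r$-set is a full-set if it contains a box of row 1 and its end-box is an outer-diagonal box $(k,n-k)$; it is a plus-full-set ($r^+$-full-set) if moreover $k=n-1$, or $k\le n-2$ and $C(k+1,n-k-1)<r$. $\mathcal C_i(n)$ = $\psi$-tableaux of shape $\delta_{n-1}$ and length $n+i$; for $r\in[n+i]$, $\mathcal F_i^r(n)$ = those $C\in\mathcal C_i(n)$ whose $r$-set is a plus-full-set and whose $j$-sets, $j\in[r-1]$, are not plus-full-sets. For $d\ge1$ and a tableau $T$, $\alpha_d(T)$ is obtained by moving every row of index $>d$ down one row and placing a copy of row $d$ (same length and labels) in row $d+1$. For a tableau $Y$ of length $r$, $\beta_d(Y)$ is obtained by appending a box labelled $r+1$ at the end of each of rows $1,\dots,d$. For $C\in\mathcal C_i(n)$ and $0\le r\le n+i$: if some $k\in[n-1]$ has $C(k,n-k)\le r$, let $d$ be the least such $k$, otherwise $d=n$. Then $\widehat C(r)$ is obtained from $\beta_d(\alpha_d(C^{(r)}))$ by adding, for each box $(x,y)$ of $C$ with $C(x,y)>r$, the box $(x,y+1)$ labelled $C(x,y)+1$ if $x<d$, and the box $(x+1,y)$ labelled $C(x,y)+1$ if $x>d$ (row $d$ of $C$ has no label exceeding $r$). *)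

(* Defs.v *)
From mathcomp Require Import all_boot all_order all_algebra.
From mathcomp Require Import classical_sets functions.
Set Implicit Arguments.
Unset Strict Implicit.
Unset Printing Implicit Defensive.

(* Rows, columns and boxes are numbered from 1.  Diagrams and tableaux are
   stored row by row without trailing empty rows, so that equality of diagrams
   and of tableaux is Leibniz equality. *)

Definition diagram := seq nat.
Definition tableau := seq (seq nat).
Definition box := (nat * nat)%type.

(* Removes the trailing copies of x0 only. *)
Fixpoint trim (A : eqType) (x0 : A) (s : seq A) : seq A :=
  if s is x :: s' then
    let t := trim x0 s' in
    if (x == x0) && (t == [::]) then [::] else x :: t
  else [::].

(* lambda_x for x >= 1; the convention lambda_0 = +oo is built into
   [prime_height]. *)
Definition rowlen (Y : diagram) (x : nat) : nat := nth 0 Y x.-1.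

Definition young_diagram (Y : diagram) : bool := sorted geq Y && (0 \notin Y).

Definition staircase (m : nat) : diagram := rev (iota 1 m).

(* h = d always qualifies since lambda_0 = +oo, so the minimum lies in [d]. *)
Definition prime_height (Y : diagram) (d : nat) : nat :=
  (find (fun h => (h == d) || (rowlen Y d + h <= rowlen Y (d - h)))
        (iota 1 d)).+1.

Definition corner_row (Y : diagram) (x : nat) : bool :=
  (0 < x <= size Y) && (rowlen Y x.+1 < rowlen Y x).

Definition delete_strip (Y : diagram) (x : nat) : diagram :=
  trim 0 [seq if x - prime_height Y x < j <= x then (rowlen Y j).-1
              else rowlen Y j | j <- iota 1 (size Y)].

(* [covers Y' Y] is the relation "Y' covers Y": deleting a strip goes up. *)
Definition covers (Y' Y : diagram) : bool :=
  has (fun x => corner_row Y x && (Y' == delete_strip Y x)) (iota 1 (size Y)).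

Definition trow (T : tableau) (x : nat) : seq nat := nth [::] T x.-1.

Definition label (T : tableau) (b : box) : nat := nth 0 (trow T b.1) b.2.-1.

Definition boxes (T : tableau) : seq box :=
  [seq (x, y) | x <- iota 1 (size T), y <- iota 1 (size (trow T x))].

Definition tab_length (T : tableau) : nat := foldr maxn 0 (flatten T).

Definition is_tableau (T : tableau) : Prop :=
  [/\ young_diagram (shape T),
      forall x y, (x, y) \in boxes T -> (x, y.+1) \in boxes T ->
        label T (x, y) < label T (x, y.+1),
      forall x y, (x, y) \in boxes T -> (x.+1, y) \in boxes T ->
        label T (x, y) <= label T (x.+1, y)
    & flatten T =i iota 1 (tab_length T)].

Definition tableau_of_rows (m : nat) (f : nat -> seq nat) : tableau :=
  trim [::] [seq f x | x <- iota 1 m].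

(* The tableau T^(r). *)
Definition tab_restrict (T : tableau) (r : nat) : tableau :=
  tableau_of_rows (size T) (fun x => [seq a <- trow T x | a <= r]).

Definition psi_tableau (T : tableau) : Prop :=
  is_tableau T /\
  forall r, 1 <= r <= tab_length T ->
    covers (shape (tab_restrict T r.-1)) (shape (tab_restrict T r)).

Definition rset (T : tableau) (r : nat) : seq box :=
  [seq b <- boxes T | label T b == r].

Definition end_box (S : seq box) (b : box) : bool :=
  (b \in S) && all (fun b' => b'.1 <= b.1) S.

(* The r-set of C, of shape [staircase n.-1], is a full-set with end-box
   (k, n - k). *)
Definition full_set_at (n : nat) (C : tableau) (r k : nat) : bool :=
  [&& 1 <= k <= n.-1, has (fun b => b.1 == 1) (rset C r)
    & end_box (rset C r) (k, n - k)].

Definition plus_full_set (n : nat) (C : tableau) (r : nat) : Prop :=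
  exists k, full_set_at n C r k /\
    (k = n.-1 \/ (k <= n - 2 /\ label C (k.+1, n - k - 1) < r)).

Definition calC (i : int) (n : nat) : set tableau :=
  [set C | [/\ psi_tableau C, shape C = staircase n.-1
             & (tab_length C)%:Z = n%:Z + i]]%R%classic.

Definition calF (i : int) (r n : nat) : set tableau :=
  [set C | [/\ calC i n C, plus_full_set n C r
             & forall j, 1 <= j <= r.-1 -> ~ plus_full_set n C j]]%classic.

Definition alpha (d : nat) (T : tableau) : tableau :=
  tableau_of_rows (size T).+1
    (fun x => if x <= d then trow T x else trow T x.-1).

(* Rows of Y among 1, ..., d that are empty receive a first box. *)
Definition beta (d : nat) (Y : tableau) : tableau :=
  tableau_of_rows (maxn d (size Y))
    (fun x => if x <= d then rcons (trow Y x) (tab_length Y).+1 else trow Y x).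

(* The search returns n.-1 when it fails, which gives the default d = n. *)
Definition hat_row (n : nat) (C : tableau) (r : nat) : nat :=
  (find (fun k => label C (k, n - k) <= r) (iota 1 n.-1)).+1.

(* Rows of C increase, so the labels exceeding r end their row; the boxes added
   to a row of Z := beta_d (alpha_d C^(r)) thus come right after its last box:
   for x < d, row x of Z has one box more than row x of C^(r), matching
   (x, y) |-> (x, y + 1); for x > d, row x + 1 of Z is row x of C^(r), matching
   (x, y) |-> (x + 1, y). *)
Definition hat (n r : nat) (C : tableau) : tableau :=
  let d := hat_row n C r in
  let Z := beta d (alpha d (tab_restrict C r)) in
  let moved x := [seq a.+1 | a <- trow C x & r < a] in
  tableau_of_rows (maxn (size Z) (size C).+1)
    (fun x => trow Z x ++ (if x < d then moved x
                          else if d < x.-1 then moved x.-1 else [::])).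

(* Main.v *)
Require Import Defs.
From mathcomp Require Import all_boot all_order all_algebra.
From mathcomp Require Import classical_sets functions.
From mathcomp Require Import zify.
Set Implicit Arguments.
Unset Strict Implicit.
Unset Printing Implicit Defensive.

(* A psi-tableau is read as a growing sequence of partitions. With
   D_s(x) = x + (length of row x at time s), step s adds a box to the rows
   c+1, ..., e, where the rows strictly between c and e have D_s < D_s(e), and
   c = 0 or D_s(c) >= D_s(e). The outer diagonal of the staircase is D = n, and
   step s is plus-full exactly when it adds a box to the rows 1, ..., k, with
   D_s(k) = n, while row k+1 already has D = n.

   If at time r row d dominates all rows above it, meaning D_r(x) < D_r(d) for
   x < d, then it does so at all earlier times. For the least row d with
   D_r(d) = n this makes it possible to duplicate row d throughout the times
   <= r: a strip ending at row d starts at row 1, and any other strip contains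
   both copies or neither. The inserted step r+1 adds a box to the rows 1..d and
   is plus-full; afterwards both copies lie on the outer diagonal and stay
   unchanged. Conversely, if step r+1 is plus-full with end-row d, domination
   shows that the rows d and d+1 agree at all times <= r, so row d+1 and step
   r+1 can be removed. *)

(** * Strip chains *)

(* [M x a] means that row x carries the label a; as rows increase strictly, this
   determines the tableau. *)
Definition marks := nat -> nat -> bool.

Definition cnt (M : marks) (s x : nat) : nat := count (M x) (iota 1 s).

Definition diag (M : marks) (s x : nat) : nat := cnt M s x + x.

(** Row e holds the corner box; row c is the nearest row above it whose diagonal is at least that of
    e, with c = 0 standing for the infinite row 0. *)
Definition strip_step (n : nat) (M : marks) (s : nat) : Prop :=
  exists c e, [/\ c < e < n, forall x, M x s = (c < x <= e),
    forall x, c < x < e -> diag M s x < diag M s e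
    & c = 0 \/ diag M s e <= diag M s c].

Definition chain (n l : nat) (M : marks) : Prop :=
  [/\ forall x a, M x a -> 0 < a <= l,
      forall x, 0 < x <= n -> cnt M l x = n - x
    & forall s, 0 < s <= l -> strip_step n M s].

(** In a chain the last condition covers both cases of a plus-full-set: row n is always empty and
    has diagonal n, and for k < n-1 it says that row k+1 has reached the outer diagonal, necessarily
    before step s. *)
Definition plus_full (n : nat) (M : marks) (s k : nat) : Prop :=
  [/\ 0 < k < n, forall x, M x s = (0 < x <= k), diag M s k = n
    & diag M s k.+1 = n].

(** Since row n of a chain stays empty, its diagonal is always n, which absorbs the default d =
    n. *)
Definition first_full (n : nat) (M : marks) (r d : nat) : Prop :=
  [/\ 0 < d <= n, diag M r d = n & forall x, 0 < x < d -> diag M r x < n].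

(* Row x of the old tableau reappears as row [skip_row d x] of the new one, and
   row x of the new one copies row [dup_row d x] of the old one. *)
Definition dup_row (d x : nat) : nat := if x <= d then x else x.-1.
Definition skip_row (d x : nat) : nat := if x <= d then x else x.+1.

Lemma dup_row_le d x : x <= d -> dup_row d x = x.
Proof. by rewrite /dup_row => ->. Qed.

Lemma dup_row_gt d x : d <= x -> dup_row d x.+1 = x.
Proof. by rewrite /dup_row ltnNge => ->. Qed.

Lemma skip_row_le d x : x <= d -> skip_row d x = x.
Proof. by rewrite /skip_row => ->. Qed.

Lemma skip_row_gt d x : d < x -> skip_row d x = x.+1.
Proof. by rewrite /skip_row ltnNge => /negbTE->. Qed.

Lemma skip_rowK d x : dup_row d (skip_row d x) = x.
Proof. by rewrite /dup_row /skip_row; case: (leqP x d); case: ifP; lia. Qed.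

(** Later labels are formally copied to rows d and d+1 as well; when row d is full at time r there
    are none. *)
Definition hat_marks (d r : nat) (M : marks) : marks := fun x a =>
  if a <= r then M (dup_row d x) a
  else if a == r.+1 then 0 < x <= d else M (dup_row d x) a.-1.

Definition unhat_marks (d r : nat) (M : marks) : marks := fun x a =>
  M (skip_row d x) (if a <= r then a else a.+1).

Lemma cntS M s x : cnt M s.+1 x = cnt M s x + M x s.+1.
Proof. by rewrite /cnt -(addn1 s) iotaD count_cat /= addn0 add1n addn1. Qed.

Lemma cnt_mono M x s t : s <= t -> cnt M s x <= cnt M t x.
Proof.
move=> /subnK <-; elim: (t - s) => [|k IH] //.
by rewrite addSn cntS (leq_trans IH) ?leq_addr.
Qed.

Lemma diagS M s x : diag M s.+1 x = diag M s x + M x s.+1.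
Proof. by rewrite /diag cntS addnAC. Qed.

Lemma chain_diag_le n l M s x : chain n l M -> s <= l -> 0 < x <= n ->
  diag M s x <= n.
Proof.
move=> [_ fin _] sl xn; have := cnt_mono M x sl.
by rewrite fin // /diag; lia.
Qed.

Lemma diag_mono M x s t : s <= t -> diag M s x <= diag M t x.
Proof. by move=> st; rewrite leq_add2r cnt_mono. Qed.

Lemma chain_full_unmarked n l M s t x : chain n l M -> 0 < x <= n ->
  diag M s x = n -> s < t -> M x t = false.
Proof.
move=> chM xn dx st; apply/negP => Mxt.
have [supp _ _] := chM; have /andP[_ tl] := supp _ _ Mxt.
have := chain_diag_le chM tl xn.
case: t st Mxt tl => // t st Mxt tl; rewrite diagS Mxt.
by have := diag_mono M x (st : s <= t); lia.
Qed.

(* Once some row above d has at least the diagonal of d, this persists: a strip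
   containing row d either contains that row too or is bounded by such a row. *)
Lemma chain_dominant n l M t d : chain n l M -> t <= l ->
  (forall x, 0 < x < d -> diag M t x < diag M t d) ->
  forall s x, s <= t -> 0 < x < d -> diag M s x < diag M s d.
Proof.
move=> [_ _ steps]; elim: t => [|t IH] tl dom s x.
  by rewrite leqn0 => /eqP-> /dom.
rewrite leq_eqVlt => /predU1P[-> /dom //|]; rewrite ltnS => st.
apply: IH st => [|y yd]; first exact: ltnW.
have [c [e [ce Me below above]]] := steps t.+1 tl.
have Mc : M c t.+1 = false by rewrite Me; lia.
have Me1 : M e t.+1 by rewrite Me; lia.
have := dom y yd; have := dom c; have := below d; move: above.
rewrite !diagS Mc Me1 (Me d) (Me y).
by have [ed|de] := eqVneq d e; [subst e|]; lia.
Qed.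

(** * Inserting a row and a step into a chain *)

Section HatMarks.
Variables (d r : nat) (M : marks).
Local Notation M' := (hat_marks d r M).

Lemma hat_marks_le x a : a <= r -> M' x a = M (dup_row d x) a.
Proof. by rewrite /hat_marks => ->. Qed.

Lemma hat_marks_new x : M' x r.+1 = (0 < x <= d).
Proof. by rewrite /hat_marks ltnn eqxx. Qed.

Lemma hat_marks_gt x a : r < a -> M' x a.+1 = M (dup_row d x) a.
Proof. by move=> ra; rewrite /hat_marks !ifN //=; lia. Qed.

Lemma cnt_hat_le s x : s <= r -> cnt M' s x = cnt M s (dup_row d x).
Proof.
by elim: s => // s IH sr; rewrite !cntS IH 1?ltnW // hat_marks_le.
Qed.

Lemma cnt_hat_gt s x : r <= s ->
  cnt M' s.+1 x = cnt M s (dup_row d x) + (0 < x <= d).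
Proof.
move=> /subnK <-; elim: (s - r) => [|k IH].
  by rewrite cntS cnt_hat_le // hat_marks_new.
rewrite addSn cntS IH cntS hat_marks_gt 1?addnAC //.
by rewrite ltnS leq_addl.
Qed.

Lemma diag_hat_le s x : s <= r ->
  diag M' s x = diag M s (dup_row d x) + (d < x).
Proof. by move=> sr; rewrite /diag cnt_hat_le // /dup_row; case: ifP; lia. Qed.

(** Rows up to d gain the new box and lower rows gain one in index. As the rise is uniform, diagonal
    comparisons at later steps are preserved. *)
Lemma diag_hat_gt s x : r <= s -> 0 < x ->
  diag M' s.+1 x = (diag M s (dup_row d x)).+1.
Proof. by move=> sr x0; rewrite /diag cnt_hat_gt // /dup_row; case: ifP;
  lia. Qed.

(** Source of injectivity, once d has been recovered. *)
Lemma hat_marksK x a : unhat_marks d r M' x a = M x a.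
Proof.
rewrite /unhat_marks; case: leqP => ar; last by rewrite hat_marks_gt ?skip_rowK.
by rewrite hat_marks_le ?skip_rowK.
Qed.

End HatMarks.

Section Hat.
Variables (n l r d : nat) (M : marks).
Hypotheses (chM : chain n l M) (rl : r <= l) (full_d : first_full n M r d).
Local Notation M' := (hat_marks d r M).

Lemma first_full_dominant s x : s <= r -> 0 < x < d ->
  diag M s x < diag M s d.
Proof.
move=> sr xd; apply: (chain_dominant chM rl _ sr xd).
by case: full_d => _ -> full_lt.
Qed.

Lemma hat_chain : chain n.+1 l.+1 M'.
Proof.
have [supp fin steps] := chM; have [dn dd dlt] := full_d.
split=> [x a | x xn | s sl].
- have [ar|] := leqP a r; first by rewrite hat_marks_le // => /supp; lia.
  case: a => // a; rewrite ltnS leq_eqVlt => /predU1P[<-|ra]; first by lia.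
  by rewrite hat_marks_gt // => /supp; lia.
- rewrite cnt_hat_gt // /dup_row.
  by have [xd|xd] := leqP x d; rewrite fin; lia.
have [sr|] := leqP s r.
- have [|c [e [ce Me below above]]] := steps s; first lia.
  have [ed|de] := ltnP e d.
    exists c, e; split; first lia.
    - move=> x; rewrite hat_marks_le // Me /dup_row; case: ifP; lia.
    - by move=> x xe; rewrite !diag_hat_le // !dup_row_le; have := below x; lia.
    case: above => [|ce']; first by left.
    by right; rewrite !diag_hat_le // !dup_row_le; lia.
  (* If 0 < c < d <= e, row c would have at least the diagonal of e, hence of d, against the
     domination by d. *)
  have [c0|dc] : c = 0 \/ d <= c.
    have [cd|] := ltnP c d; last by right.
    left; case: above => // ec.
    have [//|c0] := posnP c; have := @first_full_dominant s c sr.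
    by have := below d; have [ed|] := eqVneq d e; [subst e|]; lia.
  - exists 0, e.+1; split; [lia | | | by left].
      move=> x; rewrite hat_marks_le // Me c0 /dup_row; case: ifP; lia.
    move=> x xe; rewrite !diag_hat_le // (dup_row_gt de) //.
    have [xd|dx] := leqP x d.
      rewrite dup_row_le //; have := @first_full_dominant s x sr.
      have := below d; have [xd'|] := eqVneq x d; [subst x|];
        have [ed|] := eqVneq d e; [subst e| |subst e|]; lia.
    by case: x dx xe => // x dx xe; rewrite dup_row_gt //; have := below x; lia.
  exists c.+1, e.+1; split; first lia.
  - by move=> x; rewrite hat_marks_le // Me /dup_row; case: ifP; lia.
  - case=> // x xe; rewrite !diag_hat_le // !dup_row_gt //; try lia.
    by have := below x; lia.
  by right; case: above => [|ce']; rewrite ?diag_hat_le // ?dup_row_gt //; lia.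
case: s sl => // s sl; rewrite ltnS leq_eqVlt => /predU1P[<-|rs].
- exists 0, d; split; [lia | by move=> x; rewrite hat_marks_new | | by left].
  move=> x xd; rewrite !diag_hat_gt // ?dup_row_le; try lia.
  by rewrite dd ltnS; apply: dlt; lia.
have [|c [e [ce Me below above]]] := steps s; first lia.
(* Row d is full and gets no label after r, so a later strip lies entirely above it (e < d) or
   entirely below it (d <= c). *)
have := chain_full_unmarked chM dn dd rs; rewrite Me => Mde.
have rs' := ltnW rs.
have [ed|de] := ltnP e d.
  exists c, e; split; first lia.
  - by move=> x; rewrite hat_marks_gt // Me /dup_row; case: ifP; lia.
  - by move=> x xe; rewrite !diag_hat_gt // ?dup_row_le; have := below x; lia.
  case: above => [|ce']; first by left.
  have [->|c0] := posnP c; first by left.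
  by right; rewrite !diag_hat_gt // ?dup_row_le; lia.
have dc : d <= c by lia.
exists c.+1, e.+1; split; first lia.
- by move=> x; rewrite hat_marks_gt // Me /dup_row; case: ifP; lia.
- by case=> // x xe; rewrite !diag_hat_gt // ?dup_row_gt //; have := below x;
    lia.
by right; case: above => [|ce']; rewrite ?diag_hat_gt // ?dup_row_gt //; lia.
Qed.

Lemma hat_plus_full : plus_full n.+1 M' r.+1 d.
Proof.
have [dn dd _] := full_d.
split; [lia | exact: hat_marks_new | |].
  by rewrite diag_hat_gt // ?dup_row_le ?dd //; lia.
by rewrite diag_hat_gt // dup_row_gt // dd.
Qed.

(** Up to time r the rows 1, ..., d have diagonal at most n, so an early plus-full step must end
    below row d. Thus the insertion creates no plus-full step before r+1. *)
Lemma hat_plus_full_le s k : 0 < s <= r -> plus_full n.+1 M' s k ->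
  plus_full n M s k.-1.
Proof.
have [dn dd _] := full_d => sr [kn M's]; rewrite !diag_hat_le; try lia.
have [kd|dk] := leqP k d.
  rewrite dup_row_le // addn0 => diagk.
  by have := @chain_diag_le _ _ _ s k chM; lia.
case: k dk kn M's => // k dk kn M's;
  rewrite !dup_row_gt //= => [diagk diagk1|]; last lia.
split; [lia | | lia | lia] => x.
have := M's (skip_row d x); rewrite hat_marks_le; last lia.
by rewrite skip_rowK /skip_row => ->; case: ifP; lia.
Qed.

End Hat.

(** * Removing a row and a step from a chain *)

Section UnhatMarks.
Variables (d r : nat) (M : marks).
Local Notation N := (unhat_marks d r M).

Lemma unhat_marks_le x a : a <= r -> N x a = M (skip_row d x) a.
Proof. by rewrite /unhat_marks => ->. Qed.

Lemma unhat_marks_gt x a : r < a -> N x a = M (skip_row d x) a.+1.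
Proof. by rewrite /unhat_marks ltnNge => /negbTE->. Qed.

Lemma diag_unhat_le s x : s <= r ->
  diag N s x + (d < x) = diag M s (skip_row d x).
Proof.
move=> sr; have -> : diag N s x = cnt M s (skip_row d x) + x.
  rewrite /diag; congr (_ + _).
  by elim: s sr => // s IH sr; rewrite !cntS IH 1?ltnW // unhat_marks_le.
by rewrite /diag /skip_row; case: ifP; lia.
Qed.

Lemma diag_unhat_gt s x : (forall y, M y r.+1 = (0 < y <= d)) -> r <= s ->
  0 < x -> (diag N s x).+1 = diag M s.+1 (skip_row d x).
Proof.
move=> Mr /subnK <- x0; elim: (s - r) => [|k IH].
  rewrite diagS -diag_unhat_le // Mr /skip_row; case: ifP; lia.
by rewrite addSn diagS [RHS]diagS -IH unhat_marks_gt // ltnS leq_addl.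
Qed.

End UnhatMarks.

(** Only at x = c can row x+1 grow without row x; there the strip conditions bound the diagonal of
    c+1 by that of c after the step. *)
Lemma chain_antitone n l M s x : chain n l M -> s <= l -> 0 < x ->
  cnt M s x.+1 <= cnt M s x.
Proof.
move=> [_ _ steps]; elim: s => // s IH sl x0.
have [c [e [ce Me below above]]] := steps s.+1 sl.
have {IH} := IH (ltnW sl) x0.
have [xc|xc] := eqVneq x c; last by rewrite !cntS !Me; lia.
rewrite -xc /diag in ce below above *; have := below x.+1.
by have [xe|] := eqVneq x.+1 e; [rewrite xe | ]; lia.
Qed.

Section Unhat.
Variables (n l r d : nat) (M : marks).
Hypotheses (chM : chain n.+1 l.+1 M) (rl : r <= l).
Hypothesis (full_d : plus_full n.+1 M r.+1 d).
Local Notation N := (unhat_marks d r M).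

Let d_gt0 : 0 < d. Proof. by case: full_d => /andP[]. Qed.

(** Step r+1 is a strip with c = 0 and e = d, so row x has diagonal below n+1 after gaining a
    box. *)
Lemma plus_full_pred x : 0 < x < d -> diag M r x < n.
Proof.
have [dn Mr dd _] := full_d; have [_ _ steps] := chM.
move=> xd; have [c [e [ce Me below above]]] := steps r.+1 rl.
have ed : e = d.
  by have := Me d; have := Me e; rewrite !Mr; lia.
have c0 : c = 0.
  by have := Me 1; rewrite !Mr; lia.
have := below x; rewrite ed dd diagS Mr; lia.
Qed.

Lemma plus_full_dominant s x : s <= r -> 0 < x < d ->
  diag M s x < diag M s d.
Proof.
have [dn Mr dd _] := full_d.
move=> sr xd; apply: (chain_dominant chM (leqW rl) _ sr xd) => y yd.
by move: dd (plus_full_pred yd); rewrite diagS Mr; lia.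
Qed.

(** Row d+1 gets no box in step r+1, so it already has diagonal n+1 at time r, while the rows above
    it have at most n; such domination extends to earlier times. *)
Lemma plus_full_dominant_next s x : s <= r -> 0 < x <= d ->
  diag M s x < diag M s d.+1.
Proof.
have [dn Mr dd dd1] := full_d.
move=> sr; rewrite -(ltnS x) => xd;
  apply: (chain_dominant chM (leqW rl) _ sr xd) => y yd.
move: dd dd1 (@plus_full_pred y); rewrite !diagS !Mr.
by have [->|] := eqVneq y d; lia.
Qed.

(** Domination by row d+1 makes it at least as long as row d; the partition property gives the
    converse. *)
Lemma cnt_twin s : s <= r -> cnt M s d.+1 = cnt M s d.
Proof.
move=> sr; have := chain_antitone chM (leq_trans sr (leqW rl)) d_gt0.
have := @plus_full_dominant_next s d sr; rewrite /diag; lia.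
Qed.

Lemma marks_twin a : a != r.+1 -> M d.+1 a = M d a.
Proof.
have [dn Mr dd dd1] := full_d; have [supp _ _] := chM.
have [ar _|] := leqP a r.
  case: a ar => [|a] ar.
    by apply/idP/idP => /supp; lia.
  by have := cnt_twin ar; rewrite !cntS (cnt_twin (ltnW ar)) => /addnI;
    do 2!case: (M _ _).
move=> ra ar; rewrite !(chain_full_unmarked chM _ _ (_ : r.+1 < a)) //; lia.
Qed.

Lemma unhatK x a : hat_marks d r N x a = M x a.
Proof.
have [dn Mr _ _] := full_d.
(* The composite fixes every row except d+1, which it sends to its twin d. *)
have skipK y b : b != r.+1 -> M (skip_row d (dup_row d y)) b = M y b.
  move=> br; rewrite /dup_row; have [yd|dy] := leqP y d;
    first by rewrite skip_row_le.
  case: y dy => // y dy; have [yd|yd] := eqVneq y d.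
    by rewrite yd skip_row_le //= marks_twin.
  by rewrite skip_row_gt //=; lia.
have [ar|] := leqP a r.
  by rewrite hat_marks_le // unhat_marks_le // skipK //; lia.
case: a => // a; rewrite ltnS leq_eqVlt => /predU1P[<-|ra].
  by rewrite hat_marks_new Mr.
by rewrite hat_marks_gt // unhat_marks_gt // skipK //; lia.
Qed.

Lemma unhat_first_full : first_full n N r d.
Proof.
have [dn Mr dd dd1] := full_d; split; first lia.
  have := @diag_unhat_le d r M r d (leqnn r); rewrite skip_row_le //.
  by move: dd; rewrite diagS Mr; lia.
move=> x xd; have := @diag_unhat_le d r M r x (leqnn r).
rewrite skip_row_le; last lia.
by have := plus_full_pred xd; lia.
Qed.

Lemma unhat_chain : chain n l N.
Proof.
have [supp fin steps] := chM; have [dn Mr dd dd1] := full_d.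
split=> [x a | x xn | s sl].
- have [ar|ra] := leqP a r.
    by rewrite unhat_marks_le // => /supp; lia.
  by rewrite unhat_marks_gt // => /supp; lia.
- have := @diag_unhat_gt d r M l x Mr rl; rewrite /diag fin /skip_row;
    case: ifP; lia.
have [sr|rs] := leqP s r.
- have [|c [e [ce Me below above]]] := steps s; first lia.
  have twin : M d.+1 s = M d s by apply: marks_twin; lia.
  rewrite !Me in twin.
  have diagN x : diag N s x = diag M s (skip_row d x) - (d < x).
    by rewrite -(@diag_unhat_le d r M s x sr) addnK.
  have pos x : 0 < diag M s x.+1 by rewrite /diag addnS.
  have [ed|de] := ltnP e d.
    exists c, e; split; first lia.
    - by move=> x; rewrite unhat_marks_le // Me /skip_row; case: ifP; lia.
    - by move=> x xe; rewrite !diagN // !skip_row_le; have := below x; lia.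
    case: above => [|ce']; first by left.
    by right; rewrite !diagN // !skip_row_le; lia.
  (* A strip ending at row d would mark d but not its twin d+1. *)
  have {}de : d < e by lia.
  case: e ce Me below above twin de => // e ce Me below above twin de.
  (* For 0 < c <= d, row c would have at least the diagonal of the end-row, hence of row d+1, which
     dominates it. *)
  have [c0|dc] : c = 0 \/ d < c.
    have [cd|] := ltnP d c; [by right | left].
    case: above => // ec; have [//|c0] := posnP c.
    have := @plus_full_dominant_next s c sr; have := below d.+1.
    by have [ed|] := eqVneq d e; [subst e|]; lia.
  - exists 0, e; split; [lia | | | by left].
      by move=> x; rewrite unhat_marks_le // Me c0 /skip_row; case: ifP; lia.
    (* For e = d the strip ended at row d+1; it now ends at the twin d, which dominates the rows
       above it. *)
    move=> x xe; have [de'|de'] := eqVneq d e.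
      by subst e; rewrite !diagN !skip_row_le;
        have := @plus_full_dominant s x sr; lia.
    rewrite !diagN (@skip_row_gt d e); last lia.
    have [xd|dx] := leqP x d; last first.
      by rewrite skip_row_gt //; have := pos x; have := below x.+1; lia.
    (* The end-row loses one in diagonal; the two strict inequalities through row d+1 make up for
       this. *)
    rewrite skip_row_le //; have := @plus_full_dominant_next s x sr.
    by have := below d.+1; lia.
  case: c ce Me below above twin dc => // c ce Me below above twin dc.
  exists c, e; split; first lia.
  - by move=> x; rewrite unhat_marks_le // Me /skip_row; case: ifP; lia.
  - move=> x xe; rewrite !diagN !skip_row_gt; try lia.
    by have := pos x; have := below x.+1; lia.
  right; rewrite !diagN (@skip_row_gt d e); last lia.
  (* A strip bounded by the removed row d+1 is now bounded by its twin d. *)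
  have [cd|cd] := eqVneq c d; last by rewrite skip_row_gt; lia.
  have := cnt_twin sr; subst c; rewrite skip_row_le // /diag in above *; lia.
have [|c [e [ce Me below above]]] := steps s.+1; first lia.
(* Rows d and d+1 are both full after step r+1, so later strips lie above d or below d+1. *)
have Md : M d s.+1 = false by apply: (chain_full_unmarked chM _ dd); lia.
have Md1 : M d.+1 s.+1 = false by apply: (chain_full_unmarked chM _ dd1); lia.
have diagN x : 0 < x -> diag N s x = (diag M s.+1 (skip_row d x)).-1.
  by move=> x0; rewrite -(diag_unhat_gt Mr (ltnW rs) x0).
have pos x : 0 < x -> 0 < diag M s.+1 x by rewrite /diag; lia.
rewrite !Me in Md Md1.
have [ed|de] := ltnP e d.
  exists c, e; split; first lia.
  - by move=> x; rewrite unhat_marks_gt // Me /skip_row; case: ifP; lia.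
  - move=> x xe; rewrite !diagN // ?skip_row_le; try lia.
    by have := pos x; have := below x; lia.
  case: above => [|ce']; first by left.
  have [->|c0] := posnP c; first by left.
  by right; rewrite !diagN // ?skip_row_le; lia.
have dc : d < c by lia.
case: c ce Me below above Md Md1 dc => // c ce Me below above Md Md1 dc.
case: e ce Me below above Md Md1 de => // e ce Me below above Md Md1 de.
exists c, e; split; first lia.
- by move=> x; rewrite unhat_marks_gt // Me /skip_row; case: ifP; lia.
- move=> x xe; rewrite !diagN // ?skip_row_gt //; try lia.
  by have := pos x.+1; have := below x.+1; lia.
right; case: above => // ce'; rewrite !diagN ?(@skip_row_gt d e); try lia.
(* Here too row d replaces d+1 as bounding row: it has the largest possible diagonal, n+1. *)
have [cd|cd] := eqVneq c d; last by rewrite skip_row_gt; lia.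
subst c; rewrite skip_row_le // -!subn1 leq_sub2r //.
have rs1 : r.+1 <= s.+1 by exact: ltnW.
apply: leq_trans (diag_mono M d rs1); rewrite dd.
by apply: chain_diag_le chM _ _; lia.
Qed.

Lemma unhat_plus_full_le s k : 0 < s <= r -> plus_full n N s k ->
  plus_full n.+1 M s k.+1.
Proof.
have [dn Mr dd dd1] := full_d => sr [kn Ns Nk Nk1].
have [_ _ dlt] := unhat_first_full.
have dk : d <= k.
  rewrite leqNgt; apply/negP => kd.
  by have := @diag_mono N k s r; have := dlt k; lia.
have diagN x : d < x -> (diag N s x).+1 = diag M s x.+1.
  move=> dx; have := @diag_unhat_le d r M s x.
  by rewrite skip_row_gt // dx addn1 => ->; lia.
split; first lia.
- move=> x; rewrite -unhatK hat_marks_le; last lia.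
  by rewrite Ns /dup_row; case: ifP; lia.
(* For k = d, row k+1 is the removed row, whose length is that of its twin d. *)
- have [kd|kd] := eqVneq d k.
    rewrite -kd /diag cnt_twin ?addnS; last lia.
    have := @diag_unhat_le d r M s d; rewrite skip_row_le // /diag in Nk *.
    by rewrite -kd in Nk; lia.
  by rewrite -diagN ?Nk //; lia.
by rewrite -diagN ?Nk1 //; lia.
Qed.

End Unhat.

(** * Tableaux as trimmed lists of rows *)

Section Trim.
Variables (A : eqType) (x0 : A).
Implicit Types s t : seq A.

Lemma nth_trim s i : nth x0 (trim x0 s) i = nth x0 s i.
Proof.
elim: s i => //= x s IH i; case: ifP => [/andP[/eqP-> /eqP s0]|_].
  by case: i => [|i] //=; rewrite -IH s0 nth_nil.
by case: i => /=.
Qed.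

(** Trimming is a normal form modulo trailing defaults; equality of trimmed tableaux can thus be
    checked row by row. *)
Lemma trim_ext s t : (forall i, nth x0 s i = nth x0 t i) ->
  trim x0 s = trim x0 t.
Proof.
elim: s t => [|x s IH] [|y t] //= st.
- have t0 : trim x0 t = [::].
    have {}st i : nth x0 t i = x0 by have := st i.+1; rewrite nth_nil /= => <-.
    by elim: t st => //= z t IH /[dup] /(_ 0)/= -> st;
      rewrite IH ?eqxx // => i; apply: (st i.+1).
  by rewrite t0 -(st 0 : x0 = y) eqxx.
- have s0 : trim x0 s = [::] by rewrite (IH [::]) // => i; have := st i.+1;
    rewrite nth_nil /= => ->; rewrite nth_nil.
  by rewrite s0 (st 0 : x = x0) eqxx.
by rewrite (st 0 : x = y) (IH t) // => i; apply: (st i.+1).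
Qed.

Lemma trim_id s : trim x0 (trim x0 s) = trim x0 s.
Proof. by apply: trim_ext => i; rewrite nth_trim. Qed.

Lemma trim_notin s : x0 \notin s -> trim x0 s = s.
Proof.
elim: s => //= x s IH; rewrite inE negb_or => /andP[xx0 /IH ->].
by rewrite eq_sym (negbTE xx0).
Qed.

End Trim.

Lemma shape_trim (T : tableau) : shape (trim [::] T) = trim 0 (shape T).
Proof.
elim: T => //= u T IH; rewrite -IH -size_eq0.
rewrite -(size_eq0 (trim [::] T)) -(size_eq0 (shape _)) /shape size_map.
by case: ifP.
Qed.

Lemma rowlen_ext (Y Z : diagram) : trim 0 Y = Y -> trim 0 Z = Z ->
  (forall x, 0 < x -> rowlen Y x = rowlen Z x) -> Y = Z.
Proof. move=> tY tZ YZ; rewrite -tY -tZ; apply: trim_ext => i.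
exact: (YZ i.+1). Qed.

Lemma trow_ext (T U : tableau) : trim [::] T = T -> trim [::] U = U ->
  (forall x, 0 < x -> trow T x = trow U x) -> T = U.
Proof. move=> tT tU TU; rewrite -tT -tU; apply: trim_ext => i.
exact: (TU i.+1). Qed.

Lemma rowlen_shape (T : tableau) x : rowlen (shape T) x = size (trow T x).
Proof.
rewrite /rowlen /trow; have [xT|Tx] := ltnP x.-1 (size T).
  by rewrite (nth_map [::]).
by rewrite !nth_default // size_map.
Qed.

Lemma trow_default (T : tableau) x : size T < x -> trow T x = [::].
Proof. by case: x => // x Tx; rewrite /trow nth_default. Qed.

Lemma trow_of_rows m f x : 0 < x ->
  trow (tableau_of_rows m f) x = if x <= m then f x else [::].
Proof.
case: x => // x _; rewrite /trow nth_trim /=; case: ltnP => xm.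
  by rewrite (nth_map 0) ?size_iota // nth_iota.
by rewrite nth_default // size_map size_iota.
Qed.

Lemma trow_restrict T r x : 0 < x ->
  trow (tab_restrict T r) x = [seq a <- trow T x | a <= r].
Proof. by move=> x0; rewrite trow_of_rows //;
  case: leqP => // /trow_default->. Qed.

Lemma trow_alpha d T x : 0 < d -> 0 < x ->
  trow (alpha d T) x = trow T (dup_row d x).
Proof.
move=> d0 x0; rewrite trow_of_rows // -(fun_if (trow T)) -/(dup_row d x).
case: (leqP x (size T).+1) => // Tx; rewrite trow_default //.
by case: x x0 Tx => // x _ Tx; rewrite /dup_row; case: ifP => _; [exact: ltnW|].
Qed.

Lemma trow_beta d Y x : 0 < x -> trow (beta d Y) x =
  if x <= d then rcons (trow Y x) (tab_length Y).+1 else trow Y x.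
Proof.
move=> x0; rewrite trow_of_rows //; case: (leqP x (maxn _ _)) => // Yx.
move: Yx; rewrite gtn_max => /andP[dx Yx].
by rewrite leqNgt dx trow_default.
Qed.

Lemma mem_flatten_trow (T : tableau) a :
  a \in flatten T <-> exists2 x, 0 < x & a \in trow T x.
Proof.
split=> [/flattenP[u /(nthP [::])[i _ <-] au]|[x x0 ax]]; first by exists i.+1.
apply/flattenP; exists (trow T x) => //; rewrite mem_nth // prednK //.
by rewrite leqNgt; apply/negP => /trow_default Tx; rewrite Tx in ax.
Qed.

Lemma tab_length_eq (T : tableau) l :
  (forall x a, 0 < x -> a \in trow T x -> a <= l) ->
  (0 < l -> exists2 x, 0 < x & l \in trow T x) -> tab_length T = l.
Proof.
move=> Tl lT; have {}Tl a : a \in flatten T -> a <= l.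
  by case/mem_flatten_trow => x; apply: Tl.
have {}lT : 0 < l -> l \in flatten T by move=> /lT /mem_flatten_trow.
rewrite /tab_length; apply/eqP; rewrite eqn_leq; apply/andP; split.
  elim: (flatten T) Tl {lT} => //= a s IH Tl; rewrite geq_max Tl ?mem_head //=.
  by apply: IH => b bs; rewrite Tl // inE bs orbT.
case: posnP lT => [->//|_ /(_ isT)]; elim: (flatten T) => //= a s IH.
by rewrite inE leq_max => /predU1P[->|/IH ->]; rewrite ?leqnn ?orbT.
Qed.

Lemma mem_boxes T x y :
  ((x, y) \in boxes T) = (0 < x) && (0 < y <= size (trow T x)).
Proof.
apply/idP/idP => [/allpairsPdep[u [v []]]|/and3P[x0 y0 yT]].
  by rewrite !mem_iota => uT vT [-> ->]; lia.
apply/allpairsPdep; exists x, y; rewrite !mem_iota; split=> //; last lia.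
by rewrite x0 add1n ltnS leqNgt; apply/negP => /trow_default Tx;
  rewrite Tx /= in yT; lia.
Qed.

(** * Prime paths and the covering relation *)

Lemma prime_heightP Y e : 0 < e ->
  [/\ 0 < prime_height Y e <= e,
      prime_height Y e = e \/
        rowlen Y e + prime_height Y e <= rowlen Y (e - prime_height Y e)
    & forall h, 0 < h < prime_height Y e ->
        h <> e /\ rowlen Y (e - h) < rowlen Y e + h].
Proof.
move=> e0; rewrite /prime_height; set p := (fun h => _).
have hasp : has p (iota 1 e).
  by apply/hasP; exists e; [rewrite mem_iota; lia | rewrite /p eqxx].
have le_e : find p (iota 1 e) < e by move: hasp; rewrite has_find size_iota.
split.
- by rewrite le_e.
- have := nth_find 0 hasp; rewrite nth_iota // add1n => /orP[/eqP|];
    by [left|right].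
case=> // h /andP[_ hh].
have := before_find 0 hh; rewrite nth_iota; last lia.
by move=> /norP[/eqP he]; rewrite -ltnNge.
Qed.

Lemma rowlen_delete_strip Y e x : 0 < x -> rowlen (delete_strip Y e) x =
  if e - prime_height Y e < x <= e then (rowlen Y x).-1 else rowlen Y x.
Proof.
case: x => // x _; rewrite {1}/rowlen /delete_strip nth_trim /=.
have [xY|Yx] := ltnP x (size Y).
  by rewrite (nth_map 0) ?size_iota // nth_iota.
by rewrite nth_default ?size_map ?size_iota // /rowlen nth_default //;
  case: ifP.
Qed.

(** Put c = e - h for the prime height h: the defining inequality of h compares the diagonals of c
    and e, its minimality concerns the rows strictly between, and h = e becomes c = 0. *)
Lemma coversP Y' Y : trim 0 Y' = Y' -> reflect
  (exists c e, [/\ c < e, rowlen Y e.+1 < rowlen Y e,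
     forall x, c < x < e -> rowlen Y x + x < rowlen Y e + e,
     c = 0 \/ rowlen Y e + e <= rowlen Y c + c
   & forall x, 0 < x ->
       rowlen Y' x = if c < x <= e then (rowlen Y x).-1 else rowlen Y x])
  (covers Y' Y).
Proof.
move=> trimY'; apply: (iffP hasP) => [[e _ /andP[/andP[e0 ee] /eqP->]]|].
  have {}e0 : 0 < e by case/andP: e0.
  have [h0 hmin hlt] := @prime_heightP Y e e0.
  exists (e - prime_height Y e), e; split=> //; first lia.
  - move=> x xe; have [|_] := hlt (e - x); first lia.
    by rewrite subKn; lia.
  - by case: hmin; [left | right]; lia.
  by move=> x; exact: rowlen_delete_strip.
case=> c [e [ce ee below above Y'E]].
have e0 : 0 < e by lia.
have eY : e <= size Y.
  rewrite leqNgt; apply/negP => Ye.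
  by move: ee; rewrite {2}/rowlen nth_default //; lia.
exists e; first by rewrite mem_iota; lia.
rewrite /corner_row e0 eY ee; apply/eqP/rowlen_ext => // [|x x0].
  exact: trim_id.
rewrite rowlen_delete_strip // Y'E //.
have [h0 hmin hlt] := @prime_heightP Y e e0.
(* A smaller height contradicts [below], a larger one contradicts [above]. *)
suff -> : prime_height Y e = e - c by rewrite subKn // ltnW.
have [hc|ch|//] := ltngtP (prime_height Y e) (e - c).
  have := below (e - prime_height Y e); case: hmin; lia.
have [|] := hlt (e - c); first lia.
by rewrite subKn; [case: above|]; lia.
Qed.

(** The entries at most r form an initial segment; this turns label comparisons into row lengths at
    time r. *)
Lemma sorted_count_le (s : seq nat) r i : sorted ltn s -> i < size s ->
  (nth 0 s i <= r) = (i < count (leq^~ r) s).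
Proof.
elim: s i => //= a s IH i pas; have ss := path_sorted pas.
have [ar|ra] := leqP a r; first by case: i => //= i;
  rewrite ltnS => /(IH i ss) ->.
have s0 : count (leq^~ r) s = 0.
  apply/eqP; rewrite -leqn0 leqNgt -has_count; apply/hasPn => b bs.
  by have /allP/(_ b bs) := order_path_min ltn_trans pas; lia.
by case: i => [|i]; rewrite s0 /=; [lia | rewrite ltnS => /(IH i ss) ->; lia].
Qed.

Lemma filter_iota_le (p : pred nat) r l : r <= l ->
  [seq a <- [seq a <- iota 1 l | p a] | a <= r] = [seq a <- iota 1 r | p a].
Proof.
move=> /subnKC <-; rewrite -filter_predI iotaD filter_cat.
rewrite [X in _ ++ X](eq_in_filter (a2 := pred0)) ?filter_pred0 ?cats0.
  by apply: eq_in_filter => a; rewrite mem_iota /=; lia.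
by move=> a; rewrite mem_iota /=; lia.
Qed.

Lemma filter_iota_gt (p : pred nat) r l : r <= l ->
  [seq a <- [seq a <- iota 1 l | p a] | r < a] =
  [seq a <- iota r.+1 (l - r) | p a].
Proof.
move=> rl; rewrite -{1}(subnKC rl) -filter_predI iotaD filter_cat add1n.
rewrite [X in X ++ _](eq_in_filter (a2 := pred0)) ?filter_pred0 /=.
  by apply: eq_in_filter => a; rewrite mem_iota /=; lia.
by move=> a; rewrite mem_iota /=; lia.
Qed.

(** * Tableaux of strip chains *)

Lemma nth_staircase m i : nth 0 (staircase m) i = m - i.
Proof.
have [im|mi] := ltnP i m; last by rewrite nth_default ?size_rev ?size_iota //;
  lia.
by rewrite nth_rev size_iota // nth_iota; lia.
Qed.

Lemma rowlen_staircase m x : 0 < x -> rowlen (staircase m) x = m.+1 - x.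
Proof. by case: x => // x _; rewrite /rowlen nth_staircase. Qed.

Lemma staircase_young m : young_diagram (staircase m).
Proof.
apply/andP; split; last by rewrite mem_rev mem_iota.
by rewrite rev_sorted; apply: sub_sorted (iota_sorted 1 m).
Qed.

Definition tableau_of (n l : nat) (M : marks) : tableau :=
  tableau_of_rows n.-1 (fun x => [seq a <- iota 1 l | M x a]).

(** The guard excludes x = 0, where [trow] would return row 1. *)
Definition marks_of (T : tableau) : marks := fun x a =>
  (0 < x) && (a \in trow T x).

Lemma eq_tableau_of n l M N : (forall x a, M x a = N x a) ->
  tableau_of n l M = tableau_of n l N.
Proof.
move=> MN; congr trim; apply: eq_map => x.
by apply: eq_filter => a; rewrite MN.
Qed.

Section TableauOf.
Variables (n l : nat) (M : marks).
Hypothesis chM : chain n l M.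
Local Notation T := (tableau_of n l M).

Lemma chain_support x a : M x a -> 0 < x < n.
Proof.
have [supp _ steps] := chM => Mxa.
have [c [e [ce Me _ _]]] := steps a (supp _ _ Mxa).
by move: Mxa; rewrite Me; lia.
Qed.

Lemma trow_tableau_of x : 0 < x -> trow T x = [seq a <- iota 1 l | M x a].
Proof.
move=> x0; rewrite trow_of_rows //; case: leqP => // nx.
rewrite (eq_filter (a2 := pred0)) ?filter_pred0 // => a /=.
by apply/negP => /chain_support; lia.
Qed.

Lemma marks_of_tableau x a : marks_of T x a = M x a.
Proof.
rewrite /marks_of; case: posnP => [-> /=|x0].
  by apply/esym/negP => /chain_support.
rewrite trow_tableau_of // mem_filter mem_iota /=.
by apply: andb_idr; have [supp _ _] := chM; move=> /supp; lia.
Qed.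

Lemma size_trow_tableau_of x : 0 < x -> size (trow T x) = n - x.
Proof.
have [_ fin _] := chM => x0; rewrite trow_tableau_of // size_filter.
have [xn|nx] := leqP x n; first by rewrite -fin // x0.
rewrite (eq_count (a2 := pred0)) ?count_pred0; first lia.
by move=> a /=; apply/negP => /chain_support; lia.
Qed.

Lemma shape_tableau_of : shape T = staircase n.-1.
Proof.
apply: rowlen_ext => [||x x0].
- by rewrite -shape_trim trim_id.
- by apply: trim_notin; case/andP: (staircase_young n.-1).
by rewrite rowlen_shape size_trow_tableau_of // rowlen_staircase //; lia.
Qed.

Lemma chain_row_exists s : 0 < s <= l -> exists2 x, 0 < x & M x s.
Proof.
have [_ _ steps] := chM => /steps[c [e [ce Me _ _]]].
by exists e; rewrite ?Me; lia.
Qed.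

Lemma tab_length_tableau_of : tab_length T = l.
Proof.
apply: tab_length_eq => [x a x0 | l0].
  by rewrite trow_tableau_of // mem_filter mem_iota; lia.
have [|x x0 Mx] := @chain_row_exists l; first lia.
by exists x => //; rewrite trow_tableau_of // mem_filter mem_iota Mx; lia.
Qed.

Lemma count_trow_tableau_of r x : r <= l -> 0 < x ->
  count (leq^~ r) (trow T x) = cnt M r x.
Proof.
by move=> rl x0;
  rewrite trow_tableau_of // -size_filter filter_iota_le // size_filter.
Qed.

Lemma sorted_trow_tableau_of x : 0 < x -> sorted ltn (trow T x).
Proof.
move=> x0; rewrite trow_tableau_of // sorted_filter ?iota_ltn_sorted //.
exact: ltn_trans.
Qed.

Lemma label_tableau_of_le x y r : r <= l -> 0 < x -> 0 < y <= n - x ->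
  (label T (x, y) <= r) = (y <= cnt M r x).
Proof.
move=> rl x0 yn; rewrite /label /= sorted_count_le.
- by rewrite count_trow_tableau_of //; lia.
- exact: sorted_trow_tableau_of.
by rewrite size_trow_tableau_of //; lia.
Qed.

Lemma mem_boxes_tableau_of x y :
  ((x, y) \in boxes T) = (0 < x) && (0 < y <= n - x).
Proof. by rewrite mem_boxes; case: posnP => //= x0;
  rewrite size_trow_tableau_of. Qed.

Lemma label_tableau_of_mem x y : (x, y) \in boxes T ->
  label T (x, y) \in trow T x.
Proof. by rewrite mem_boxes => /and3P[x0 y0 yT];
  rewrite mem_nth //= prednK. Qed.

Lemma label_tableau_of_range x y : (x, y) \in boxes T -> 0 < label T (x, y) <=
  l.
Proof.
move=> xyT; have := label_tableau_of_mem xyT.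
rewrite trow_tableau_of; first by rewrite mem_filter mem_iota; lia.
by move: xyT; rewrite mem_boxes => /andP[].
Qed.

Lemma rowlen_restrict_tableau_of s x : s <= l -> 0 < x ->
  rowlen (shape (tab_restrict T s)) x = cnt M s x.
Proof.
move=> sl x0; rewrite rowlen_shape trow_restrict // size_filter.
exact: count_trow_tableau_of.
Qed.

Lemma tableau_of_psi : psi_tableau T.
Proof.
have [supp fin steps] := chM; split.
  split.
  - by rewrite shape_tableau_of staircase_young.
  - move=> x y; rewrite !mem_boxes_tableau_of => xy xy1.
    have x0 : 0 < x by lia.
    have := sorted_trow_tableau_of x0 => /(sortedP 0) srt.
    have := srt y.-1; rewrite size_trow_tableau_of // /label /= prednK;
      last lia.
    by apply; lia.
  - move=> x y xyT xy1T; have := label_tableau_of_range xy1T.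
    move: xyT xy1T; rewrite !mem_boxes_tableau_of => xy xy1 lr.
    (* At the time given by the lower label, row x+1 has at least y boxes, hence so has row x. *)
    have [_ sl] := andP lr; rewrite label_tableau_of_le //; try lia.
    apply: leq_trans (chain_antitone chM sl _); last lia.
    by rewrite -label_tableau_of_le //; lia.
  move=> a; rewrite tab_length_tableau_of; apply/idP/idP.
    case/mem_flatten_trow => x x0; rewrite trow_tableau_of // mem_filter.
    by case/andP.
  rewrite mem_iota => al; apply/mem_flatten_trow.
  have [|x x0 Mx] := @chain_row_exists a; first lia.
  by exists x => //; rewrite trow_tableau_of // mem_filter mem_iota Mx.
rewrite tab_length_tableau_of => s sl.
apply/coversP; first by rewrite -shape_trim trim_id.
have [c [e [ce Me below above]]] := steps s sl.
have sl' : s <= l by lia.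
exists c, e; split.
- by lia.
- rewrite !rowlen_restrict_tableau_of //; try lia.
  (* The corner condition: row lengths decrease weakly at time s-1, and step s lengthens row e but
     not row e+1. *)
  have := @chain_antitone n l M s.-1 e chM.
  by move: Me; case: s sl sl' {below above} => // s sl sl' Me;
    rewrite !cntS !Me /=; lia.
- by move=> x xe; rewrite !rowlen_restrict_tableau_of; try lia; apply: below.
- case: above => [|ce']; first by left.
  have [->|c0] := posnP c; first by left.
  by right; rewrite !rowlen_restrict_tableau_of //; lia.
move=> x x0; rewrite !rowlen_restrict_tableau_of //; try lia.
by move: Me; case: s sl sl' {below above} => // s sl sl' Me;
  rewrite /= !cntS !Me; case: (c < x <= e); lia.
Qed.

Lemma mem_rset_tableau_of x s :
  0 < s <= l -> (exists y, (x, y) \in rset T s) <-> M x s.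
Proof.
move=> sl; split=> [[y]|Mxs].
  rewrite mem_filter => /andP[/eqP <- /[dup] /label_tableau_of_mem ls].
  rewrite mem_boxes => /andP[x0 _]; rewrite trow_tableau_of // mem_filter in ls.
  by case/andP: ls.
have /andP[x0 xn] := chain_support Mxs.
have sT : s \in trow T x by rewrite trow_tableau_of // mem_filter mem_iota Mxs;
  lia.
exists (index s (trow T x)).+1; rewrite mem_filter mem_boxes x0 /=.
by rewrite /label /= nth_index // eqxx index_mem.
Qed.

Lemma plus_full_set_tableau_of s : 0 < s <= l ->
  plus_full_set n T s <-> exists k, plus_full n M s k.
Proof.
move=> sl; have [supp fin steps] := chM; have sl' : s <= l by lia.
split=> [[k [/and3P[kn row1 /andP[endk endle] next]]]|[k [kn Ms Mk Mk1]]].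
  have {row1} M1 : M 1 s.
    have /hasP[[x y] xyT /= /eqP x1] := row1.
    by rewrite x1 in xyT; apply/mem_rset_tableau_of => //; exists y.
  have {}endle x : M x s -> x <= k.
    by move/(mem_rset_tableau_of x sl) => [y xyT];
      have /allP/(_ _ xyT) := endle.
  have Mks : M k s by apply/mem_rset_tableau_of => //; exists (n - k).
  move: endk; rewrite mem_filter => /andP[/eqP lk kT].
  have [c [e [ce Me _ _]]] := steps s sl.
  have dk : diag M s k = n.
    have := @chain_diag_le _ _ _ s k chM sl'.
    have := @label_tableau_of_le k (n - k) s sl'; rewrite lk leqnn /diag; lia.
  exists k; split=> //; first lia.
    have := endle e; move: M1 Mks; rewrite !Me => M1 Mks ek x.
    by rewrite Me; lia.
  have := @chain_diag_le _ _ _ s k.+1 chM sl'.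
  (* For k = n-1 the index of row k+1 alone gives diagonal n; otherwise the label of its
     outer-diagonal box does. *)
  case: next => [|[k2 lk1]]; first by rewrite /diag; lia.
  have := @label_tableau_of_le k.+1 (n - k - 1) s sl'; rewrite ltnW // /diag;
    lia.
have label_k : label T (k, n - k) = s.
  apply/eqP; rewrite eqn_leq label_tableau_of_le //; try lia.
  have -> : n - k <= cnt M s k by rewrite /diag in Mk; lia.
  (* A smaller label would mean that row k was full before step s, which still adds a box to it. *)
  rewrite leqNgt /=; apply/negP => lts.
  have := @label_tableau_of_le k (n - k) s.-1.
  have -> : label T (k, n - k) <= s.-1 by lia.
  move: Mk (Ms k); rewrite /diag; case: s sl {sl' Ms Mk1 lts} => // s sl.
  by rewrite cntS => + Ms'; rewrite Ms' /=; lia.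
exists k; split.
  apply/and3P; split; first lia.
    have [y y1] : exists y, (1, y) \in rset T s.
      by apply/mem_rset_tableau_of => //; rewrite Ms; lia.
    by apply/hasP; exists (1, y).
  apply/andP; split;
    first by rewrite mem_filter label_k eqxx mem_boxes_tableau_of; lia.
  apply/allP => [[x y] xyT] /=.
  have : M x s by apply/mem_rset_tableau_of => //; exists y.
  by rewrite Ms; lia.
have [|kn1] := eqVneq k n.-1; [by left | right; split; first lia].
(* Step s adds no box to row k+1, so that row was full at time s-1. *)
have -> : forall a, (a < s) = (a <= s.-1) by move=> a; lia.
rewrite label_tableau_of_le; try lia.
move: Mk1 (Ms k.+1); rewrite /diag; case: s sl {sl' Ms Mk label_k} => // s sl.
by rewrite cntS => + Ms'; rewrite Ms' /=; lia.
Qed.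

Lemma hat_row_first_full r : 0 < n -> r <= l -> first_full n M r (hat_row n T
  r).
Proof.
move=> n_gt0 rl; rewrite /hat_row; set p := (fun k => _).
have pE k : 0 < k < n -> p k = (diag M r k == n).
  move=> kn; rewrite /p label_tableau_of_le; try lia.
  by have := @chain_diag_le _ _ _ r k chM rl; rewrite /diag; lia.
have := find_size p (iota 1 n.-1); rewrite size_iota => fn.
split; first lia.
  have [ff|ff] := ltnP (find p (iota 1 n.-1)) n.-1.
    have hasp : has p (iota 1 n.-1) by rewrite has_find size_iota.
    have := nth_find 0 hasp; rewrite nth_iota // add1n pE; last lia.
    by move/eqP.
  (* A failed search returns the empty row n, of diagonal n. *)
  have -> : (find p (iota 1 n.-1)).+1 = n by lia.
  have := @chain_diag_le _ _ _ r n chM rl; rewrite /diag; lia.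
case=> // x xf; have := @before_find _ 0 p (iota 1 n.-1) x.
rewrite nth_iota; last lia.
rewrite add1n pE; last lia.
have := @chain_diag_le _ _ _ r x.+1 chM rl; lia.
Qed.

End TableauOf.

(** * The map [hat] on tableaux of chains *)

Lemma trow_hat n r C x : 0 < x ->
  let d := hat_row n C r in
  let moved x := [seq a.+1 | a <- trow C x & r < a] in
  trow (hat n r C) x = trow (beta d (alpha d (tab_restrict C r))) x ++
    (if x < d then moved x else if d < x.-1 then moved x.-1 else [::]).
Proof.
move=> x0 d moved; rewrite trow_of_rows //; case: (leqP x (maxn _ _)) => //.
rewrite gtn_max => /andP[Zx Cx]; rewrite (trow_default Zx).
have moved0 y : size C < y -> moved y = [::].
  by rewrite /moved => /trow_default ->.
case: ifP => _; first by rewrite moved0 // ltnW.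
by case: ifP => _ //; rewrite moved0 //; case: x Cx {x0 Zx}.
Qed.

Section HatTableauOf.
Variables (n l r : nat) (M : marks).
Hypotheses (n_gt0 : 0 < n) (chM : chain n l M) (rl : r <= l).
Local Notation T := (tableau_of n l M).

Lemma hat_tableau_of :
  hat n r T = tableau_of n.+1 l.+1 (hat_marks (hat_row n T r) r M).
Proof.
have full_d := hat_row_first_full chM n_gt0 rl.
apply: trow_ext; [exact: trim_id | exact: trim_id |] => x x0.
rewrite trow_hat // (trow_tableau_of (hat_chain chM rl full_d)) //.
move: (hat_row n T r) full_d => d full_d.
have [dn dd dlt] := full_d; have [supp _ _] := chM.
have d0 : 0 < d by lia.
have dup_gt0 y : 0 < y -> 0 < dup_row d y.
  by rewrite /dup_row; case: ifP; lia.
have skip_gt0 y : 0 < y -> 0 < skip_row d y.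
  by rewrite /skip_row; case: ifP; lia.
have rowY y : 0 < y ->
    trow (alpha d (tab_restrict T r)) y = [seq a <- iota 1 r | M (dup_row d y)
      a].
  move=> y0; rewrite trow_alpha // trow_restrict ?dup_gt0 //.
  by rewrite (trow_tableau_of chM) ?filter_iota_le ?dup_gt0.
(* This ensures that the label appended by [beta] is r+1. *)
have lenY : tab_length (alpha d (tab_restrict T r)) = r.
  apply: tab_length_eq => [y a y0 | r0].
    by rewrite rowY // mem_filter mem_iota; lia.
  have [|y y0 My] := @chain_row_exists _ _ _ chM r; first lia.
  exists (skip_row d y); first exact: skip_gt0.
  by rewrite rowY ?skip_rowK ?mem_filter ?mem_iota ?My ?skip_gt0 //; lia.
have moved y : 0 < y -> [seq a.+1 | a <- trow T y & r < a] =
    [seq a <- iota r.+2 (l - r) | M y a.-1].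
  move=> y0; rewrite (trow_tableau_of chM) // filter_iota_gt //.
  by rewrite -(add1n r.+1) iotaDl filter_map.
(* Reconciles [hat], which moves nothing from row d, with [hat_marks], which formally copies its
   later labels. *)
have moved_d : [seq a <- iota r.+2 (l - r) | M d a.-1] = [::].
  rewrite (eq_in_filter (a2 := pred0)) ?filter_pred0 // => a.
  rewrite mem_iota => ar; by rewrite (chain_full_unmarked chM dn dd) //; lia.
have -> : iota 1 l.+1 = iota 1 r ++ r.+1 :: iota r.+2 (l - r).
  by rewrite -[in LHS](subnKC rl) -addnS iotaD add1n.
rewrite filter_cat /= hat_marks_new x0 /=.
rewrite (@eq_in_filter _ (hat_marks d r M x) (M (dup_row d x)) (iota 1 r));
  last first.
  by move=> a; rewrite mem_iota => ar; rewrite hat_marks_le //; lia.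
rewrite (@eq_in_filter _ (hat_marks d r M x) (fun a =>
  M (dup_row d x) a.-1) (iota r.+2 _)); last first.
  by move=> [|a]; rewrite mem_iota => ar; [|rewrite hat_marks_gt //]; lia.
rewrite trow_beta // lenY rowY //.
have [xd|dx] := leqP x d.
  rewrite cat_rcons dup_row_le //; have [x_d|d_x] := ltnP x d.
    by rewrite moved.
  have -> : x = d by lia.
  by rewrite moved_d ifN //; lia.
rewrite ifN; last lia.
case: x x0 dx => //= x _ dx; rewrite dup_row_gt //.
have [d_x|x_d] := ltnP d x; first by rewrite moved //; lia.
have -> : x = d by lia.
by rewrite moved_d.
Qed.

End HatTableauOf.

(** * From psi-tableaux to strip chains *)

Lemma sorted_filter_le (s : seq nat) r : sorted ltn s -> 0 \notin s ->
  [seq a <- s | a <= r] = [seq a <- iota 1 r | a \in s].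
Proof.
move=> srt s0; apply: (irr_sorted_eq ltn_trans ltnn).
- by rewrite sorted_filter //; apply: ltn_trans.
- by rewrite sorted_filter ?iota_ltn_sorted //; apply: ltn_trans.
move=> a; rewrite !mem_filter mem_iota add1n ltnS andbC;
  case: (boolP (a \in s)) => //= ain.
by case: a ain => [/(negP s0)|a]; rewrite ?andTb.
Qed.

Section MarksOf.
Variables (n : nat) (T : tableau).
Hypotheses (psiT : psi_tableau T) (shT : shape T = staircase n.-1).
Local Notation M := (marks_of T).
Local Notation l := (tab_length T).

Lemma trow_sorted x : 0 < x -> sorted ltn (trow T x).
Proof.
move=> x0; have [[_ strict _ _] _] := psiT.
apply/(sortedP 0) => i ilt; have := strict x i.+1; rewrite !mem_boxes x0 ilt /=.
by rewrite /label /=; apply => //; exact: ltnW.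
Qed.

Lemma trow_range x a : 0 < x -> a \in trow T x -> 0 < a <= l.
Proof.
have [[_ _ _ flatT] _] := psiT => x0 ax.
have : a \in flatten T by apply/mem_flatten_trow; exists x.
by rewrite flatT mem_iota; lia.
Qed.

Lemma size_trow x : 0 < x -> size (trow T x) = n - x.
Proof. by move=> x0; rewrite -rowlen_shape shT rowlen_staircase //; lia. Qed.

Lemma restrict_trow r x : 0 < x ->
  [seq a <- trow T x | a <= r] = [seq a <- iota 1 r | M x a].
Proof.
move=> x0; rewrite sorted_filter_le ?trow_sorted //.
  by apply: eq_filter => a; rewrite /marks_of x0.
by apply/negP => /(trow_range x0).
Qed.

Lemma trow_marks x : 0 < x -> trow T x = [seq a <- iota 1 l | M x a].
Proof.
move=> x0; rewrite -restrict_trow //; apply/esym/all_filterP/allP => a.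
by move/(trow_range x0)/andP => [].
Qed.

Lemma rowlen_restrict s x : 0 < x ->
  rowlen (shape (tab_restrict T s)) x = cnt M s x.
Proof.
by move=> x0;
  rewrite rowlen_shape trow_restrict // restrict_trow // size_filter.
Qed.

Lemma cnt_tab_length x : 0 < x -> cnt M l x = n - x.
Proof. by move=> x0; rewrite /cnt -size_filter -trow_marks // size_trow. Qed.

Lemma cover_step s : 0 < s <= l ->
  exists c e, [/\ c < e, cnt M s e.+1 < cnt M s e,
    forall x, c < x < e -> diag M s x < diag M s e,
    c = 0 \/ diag M s e <= diag M s c
  & forall x, 0 < x ->
      cnt M s.-1 x = if c < x <= e then (cnt M s x).-1 else cnt M s x].
Proof.
have [_ cov] := psiT => /cov /coversP[|c [e [ce ee below above prev]]].
  by rewrite -shape_trim trim_id.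
have e0 : 0 < e by lia.
exists c, e; split=> //.
- by move: ee; rewrite !rowlen_restrict.
- by move=> x xe; have := below x xe; rewrite !rowlen_restrict //; lia.
- have [c0|c0] := posnP c; first by left.
  by case: above; [left | right; move: b; rewrite !rowlen_restrict].
by move=> x x0; have := prev x x0; rewrite !rowlen_restrict.
Qed.

(* Backward induction from the staircase: deleting a strip from a partition
   leaves a partition. *)
Lemma cnt_antitone s x y : s <= l -> 0 < x <= y -> cnt M s y <= cnt M s x.
Proof.
move=> sl /andP[x0 /subnKC <-]; elim: (y - x) => [|k IH];
  first by rewrite addn0.
apply: leq_trans IH; rewrite addnS;
  move: (x + k) (ltn_addr k x0) => {k y x0}x x0.
rewrite -(subKn sl); elim: (l - s) (leq_subr s l) => [|k IH] kl.
  by rewrite subn0 !cnt_tab_length //; lia.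
have {IH} := IH (ltnW kl).
have [|c [e [ce ee below above prev]]] := @cover_step (l - k); first lia.
have := prev x x0; have := prev x.+1 isT.
have -> : (l - k).-1 = l - k.+1 by lia.
move=> -> ->; have [->|] := eqVneq x e; do 2![case: ifP]; lia.
Qed.

Lemma marks_of_chain : chain n l M.
Proof.
split=> [x a /andP[x0]|x|s sl]; first exact: trow_range.
  by case/andP=> x0 _; exact: cnt_tab_length.
have [c [e [ce ee below above prev]]] := cover_step sl.
have sl' : s <= l by lia.
exists c, e; split=> //.
  (* Row e is nonempty at time s, so its final length n - e is positive. *)
  have := cnt_mono M e sl'; rewrite cnt_tab_length; lia.
move=> x; have [->|x0] := posnP x; first by rewrite /marks_of; lia.
(* Rows of the strip are nonempty, so the truncated predecessor really removes a box, namely one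
   labelled s. *)
have pos : x <= e -> 0 < cnt M s x.
  by move=> xe; apply: leq_trans (cnt_antitone sl' _);
    [exact: leq_trans ee | lia].
have := prev x x0; case: s {below above prev sl' ee} sl pos => // s _.
by rewrite cntS /=; case: (M x s.+1); case: ifP; lia.
Qed.

Lemma tableau_of_marks : T = tableau_of n l M.
Proof.
have [[/andP[_ nz] _ _ _] _] := psiT.
apply: trow_ext => [||x x0];
  last by rewrite (trow_tableau_of marks_of_chain) // trow_marks.
  by apply: trim_notin; apply: contra nz => /(map_f size).
exact: trim_id.
Qed.

End MarksOf.

(** * The bijection *)

Lemma first_full_inj n M r d e :
  first_full n M r d -> first_full n M r e -> d = e.
Proof.
move=> [dn dd dlt] [en ee elt].
by have := dlt e; have := elt d; lia.
Qed.

Lemma calC_tableau_of i n l M : chain n l M -> (l%:Z = n%:Z + i)%R ->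
  calC i n (tableau_of n l M).
Proof.
move=> chM ln; split.
- exact: tableau_of_psi chM.
- exact: shape_tableau_of chM.
by rewrite (tab_length_tableau_of chM).
Qed.

Lemma calC_chain i n T : calC i n T ->
  chain n (tab_length T) (marks_of T) /\
  T = tableau_of n (tab_length T) (marks_of T).
Proof. by case=> psiT shT _; split;
  [exact: marks_of_chain | exact: tableau_of_marks]. Qed.

Theorem theorem4p8 (i : int) (n r : nat)
    (hi : (-1 <= i)%R) (hn : 1 <= n) (hr : (r%:Z <= n%:Z + i)%R) :
  set_bij
    [set C | calC i n C /\ forall j, 1 <= j <= r -> ~ calF i j n C]%classic
    (calF i r.+1 n.+1)
    (hat n r).
Proof.
split.
- move=> C [CC noF].
  have [chC EC] := calC_chain CC; have [_ _ lC] := CC.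
  have rl : r <= tab_length C by lia.
  have full_d := hat_row_first_full chC hn rl; rewrite -EC in full_d.
  have chH := hat_chain chC rl full_d.
  rewrite EC (hat_tableau_of hn chC rl) -EC.
  split.
  + by apply: calC_tableau_of chH _; lia.
  + apply/(plus_full_set_tableau_of chH); first lia.
    by exists (hat_row n C r); exact: hat_plus_full full_d.
  move=> j jr /(plus_full_set_tableau_of chH)[|k]; first lia.
  move=> /(hat_plus_full_le chC rl full_d) pfk.
  have {pfk} : plus_full_set n C j.
    rewrite EC; apply/(plus_full_set_tableau_of chC); first lia.
    by exists k.-1; apply: pfk; lia.
  (* [noF] only concerns the first plus-full label; strong induction rules out smaller ones. *)
  elim/ltn_ind: j jr => j IH jr pfj; apply: (noF j); first lia.
  split=> // j' j'j; apply: IH; lia.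
- move=> C1 C2 /set_mem[CC1 _] /set_mem[CC2 _].
  have [ch1 E1] := calC_chain CC1; have [_ _ l1] := CC1.
  have [ch2 E2] := calC_chain CC2; have [_ _ l2] := CC2.
  have ll : tab_length C1 = tab_length C2 by lia.
  have rl1 : r <= tab_length C1 by lia.
  have rl2 : r <= tab_length C2 by lia.
  have full1 := hat_row_first_full ch1 hn rl1; rewrite -E1 in full1.
  have full2 := hat_row_first_full ch2 hn rl2; rewrite -E2 in full2.
  rewrite {1}E1 {1}E2 (hat_tableau_of hn ch1 rl1) (hat_tableau_of hn ch2 rl2)
    -E1 -E2.
  move: (hat_row n C1 r) (hat_row n C2 r) full1 full2 => d1 d2 full1 full2 HH.
  have eqM x a : hat_marks d1 r (marks_of C1) x a = hat_marks d2 r (marks_of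
    C2) x a.
    rewrite -(marks_of_tableau (hat_chain ch1 rl1 full1)) HH.
    by rewrite (marks_of_tableau (hat_chain ch2 rl2 full2)).
  (* The rows labelled r+1 are exactly 1, ..., d, so the image determines d. *)
  have d12 : d1 = d2.
    have [d1n _ _] := full1; have [d2n _ _] := full2.
    have := eqM d1 r.+1; have := eqM d2 r.+1; rewrite !hat_marks_new; lia.
  rewrite E1 E2 ll; apply: eq_tableau_of => x a.
  by rewrite -(hat_marksK d1 r) /unhat_marks eqM d12 -/(unhat_marks d2 r _ x
    a) hat_marksK.
move=> C' [CC' pf nopf].
have [chC' EC'] := calC_chain CC'; have [_ _ lC'] := CC'.
have [l lE] : exists l, tab_length C' = l.+1 by exists (tab_length C').-1; lia.
rewrite lE in chC' EC'; have rl : r <= l by lia.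
have [d pfd] : exists d, plus_full n.+1 (marks_of C') r.+1 d.
  by apply/(plus_full_set_tableau_of chC'); [lia | rewrite -EC'].
have chN := unhat_chain chC' rl pfd.
exists (tableau_of n l (unhat_marks d r (marks_of C'))); last first.
  have full_d := unhat_first_full chC' rl pfd.
  rewrite (hat_tableau_of hn chN rl) [RHS]EC'; apply: eq_tableau_of => x a.
  have <- := first_full_inj full_d (hat_row_first_full chN hn rl).
  exact: unhatK chC' rl pfd x a.
split; first by apply: calC_tableau_of chN _; lia.
(* A plus-full label j <= r of the preimage would be plus-full in C' too, one row lower. *)
move=> j jr [_ + _] => /(plus_full_set_tableau_of chN)[|k pfk]; first lia.
apply: (nopf j); first lia.
rewrite EC'; apply/(plus_full_set_tableau_of chC'); first lia.
by exists k.+1; apply: unhat_plus_full_le chC' rl pfd _ _ _ pfk.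
Qed.
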